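(* For every integer $m\ge 0$ and every complex $d$ with $\mathrm{Re}(d)>0$, \[ {}_3F_2\!\left(\begin{matrix}\tfrac12+m,\ \tfrac12-m,\ d+1\\ \tfrac52+m,\ d\end{matrix};1\right)=\Big(1+\frac{1-2m}{2d}\Big)\frac{3\pi}{2^{2m+3}\,m!}\,(\tfrac52)_m. \]
   Context: For $\lambda\in\mathbb{C}$ and integer $n\ge0$, $(\lambda)_n$ is the Pochhammer symbol: $(\lambda)_0=1$, $(\lambda)_n=\lambda(\lambda+1)\cdots(\lambda+n-1)$ for $n\ge1$. The generalized hypergeometric series is ${}_pF_q\!\left(\begin{matrix}\alpha_1,\dots,\alpha_p\\ \beta_1,\dots,\beta_q\end{matrix};z\right)=\sum_{k=0}^\infty \frac{(\alpha_1)_k\cdots(\alpha_p)_k}{(\beta_1)_k\cdots(\beta_q)_k}\frac{z^k}{k!}$; for $p=q+1$ and $z=1$ it converges when $\mathrm{Re}\big(\sum_j\beta_j-\sum_j\alpha_j\big)>0$. *)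

(* Defs.v *)
From Stdlib Require Import Reals Factorial List.
From Coquelicot Require Import Coquelicot.
Import ListNotations.
Open Scope C_scope.

Fixpoint pochhammer (l : C) (n : nat) : C :=
  match n with
  | O => 1
  | S k => pochhammer l k * (l + INR k)
  end.

Definition pochhammer_prod (ls : list C) (n : nat) : C :=
  fold_right (fun l acc => pochhammer l n * acc) 1 ls.

(* The p and q of pFq are the lengths of [alphas] and [betas].  This is the
   usual series only if no entry of [betas] is a non-positive integer; otherwise
   terms with a zero denominator have no meaning. *)
Definition hypergeom_term (alphas betas : list C) (z : C) (k : nat) : C :=
  pochhammer_prod alphas k / pochhammer_prod betas k * (z ^ k / INR (fact k)).

(* The series pFq(alphas; betas; z) converges in C and its sum is [s]. *)
Definition is_hypergeom (alphas betas : list C) (z s : C) : Prop :=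
  is_series (hypergeom_term alphas betas z) s.

(* Main.v *)
Require Import Defs.
From Stdlib Require Import Reals Factorial List Lra Lia.
From Coquelicot Require Import Coquelicot.
Import ListNotations.
Open Scope R_scope.

(** Since [(1/2+m)_k / (5/2+m)_k] is rational in [k] and [(d+1)_k / (d)_k = 1 + k/d],
    the [k]-th term is [t_m(k) * (1 + k/d)], where
    [t_m(k) = (2m+1)(2m+3) / ((2k+2m+1)(2k+2m+3)) * (1/2-m)_k / k!].
    Three telescoping identities reduce everything to one series:
    [k * t_m(k)] agrees with [(1/2-m) * t_m(k)] up to a difference, which gives the
    factor [1 + (1-2m)/(2d)]; [4(m+1) * t_(m+1)(k)] agrees with [(5/2+m) * t_m(k)] up to
    a difference, which gives the induction on [m]; and [t_0] agrees up to a difference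
    with 3/4 of the series of [arcsin 1 = PI/2].  The boundary terms vanish because
    [(1/2-m)_k / k!] tends to 0. *)

(** * Convergence tools for real sequences and series *)

(** The parameter [d] enters the sum only through the constant [/ d], so all analysis can be done
    over the reals and transported at the end. *)
Lemma is_series_RtoC (a : nat -> R) (l : R) :
  is_series a l -> @is_series C_AbsRing C_NormedModule (fun k => RtoC (a k)) (RtoC l).
Proof.
  intros H.
  assert (E : forall n, RtoC (sum_n a n)
                        = sum_n (fun k => RtoC (a k) : C_NormedModule) n).
  { induction n as [|n IH].
    - now rewrite !sum_O.
    - rewrite !sum_Sn, <- IH. apply RtoC_plus. }
  apply filterlim_ext with (1 := E).
  apply (filterlim_comp _ _ _ _ RtoC _ _ _ H).
  (* Balls of [C] are products of real balls, and both imaginary parts are 0. *)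
  intros P [eps HP]. exists eps. intros y Hy. apply HP.
  split; [exact Hy | apply ball_center].
Qed.

Lemma is_series_telescope (U : nat -> R) :
  is_lim_seq U 0 -> is_series (fun k => U (S k) - U k) (- U 0%nat).
Proof.
  intros H.
  assert (E : forall n, U (S n) - U 0%nat = sum_n (fun k => U (S k) - U k) n).
  { induction n as [|n IH].
    - now rewrite sum_O.
    - rewrite sum_Sn, <- IH. unfold plus; simpl. ring. }
  change (is_lim_seq (sum_n (fun k => U (S k) - U k)) (- U 0%nat)).
  apply (is_lim_seq_ext _ _ _ E).
  replace (Finite (- U 0%nat)) with (Finite (0 - U 0%nat)) by (f_equal; ring).
  apply is_lim_seq_minus' with (1 := proj1 (is_lim_seq_incr_1 U 0) H).
  apply is_lim_seq_const.
Qed.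

(** Each sequence telescoped below is a bounded rational function of [k] times a null sequence
    [binom_coeff]. *)
Lemma is_lim_seq_bounded_mult (b u : nat -> R) (M : R) :
  (forall k, Rabs (b k) <= M) -> is_lim_seq u 0 ->
  is_lim_seq (fun k => b k * u k) 0.
Proof.
  intros Hb Hu. apply is_lim_seq_abs_0.
  apply (is_lim_seq_le_le (fun _ => 0) _ (fun k => M * Rabs (u k))).
  - intros k. split; [apply Rabs_pos|]. rewrite Rabs_mult.
    apply Rmult_le_compat_r; [apply Rabs_pos | apply Hb].
  - apply is_lim_seq_const.
  - replace (Finite 0) with (Rbar_mult M 0) by (simpl; f_equal; ring).
    apply is_lim_seq_scal_l. now apply -> is_lim_seq_abs_0.
Qed.

Lemma is_lim_seq_inv_INR_succ : is_lim_seq (fun k => / (INR k + 1)) 0.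
Proof.
  apply (is_lim_seq_ext (fun k => / INR (S k))).
  - intros k. now rewrite S_INR.
  - apply (is_lim_seq_incr_1 (fun k => / INR k)).
    replace (Finite 0) with (Rbar_inv p_infty) by reflexivity.
    apply is_lim_seq_inv; [apply is_lim_seq_INR | discriminate].
Qed.

(** * Binomial coefficients of half-integer exponent and their decay *)

(* [(1/2 - m)_k / k!], the coefficient of [x^k] in [(1 - x)^(m - 1/2)]. *)
Fixpoint binom_coeff (m k : nat) : R :=
  match k with
  | O => 1
  | S j => binom_coeff m j * (INR j + / 2 - INR m) / (INR j + 1)
  end.

Ltac nonneg_INR :=
  repeat match goal with
  | n : nat |- _ =>
      lazymatch goal with
      | _ : 0 <= INR n |- _ => fail
      | _ => pose proof (pos_INR n)
      end
  end.

(** A parity argument; it keeps the factors [2m + 1 - 2k] invertible. *)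
Lemma half_integer_neq (k m : nat) : INR k - INR m - / 2 <> 0.
Proof.
  rewrite !INR_IZR_INZ. intros H.
  assert (E : IZR (2 * Z.of_nat k - 2 * Z.of_nat m) = IZR 1).
  { rewrite minus_IZR, !mult_IZR. lra. }
  apply eq_IZR in E. lia.
Qed.

(** The products [(1/2-m)_k] and [(-1/2-m)_k] differ only in an end factor: [k - 1/2 - m] for the
    former, [-1/2 - m] for the latter. *)
Lemma binom_coeff_S (m k : nat) :
  binom_coeff m k * (2 * INR m + 1)
  = binom_coeff (S m) k * (2 * INR m + 1 - 2 * INR k).
Proof.
  induction k as [|k IH].
  - simpl. ring.
  - cbn [binom_coeff]. rewrite !S_INR in *. nonneg_INR.
    pose proof (half_integer_neq k m).
    apply Rmult_eq_reg_r with (INR k + 1); [|lra].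
    transitivity ((binom_coeff m k * (2 * INR m + 1)) * (INR k + / 2 - INR m));
      [field; lra|].
    rewrite IH. field. lra.
Qed.

Lemma binom_coeff_0_pos (k : nat) : 0 < binom_coeff 0 k.
Proof.
  induction k as [|k IH]; simpl; [lra|]. nonneg_INR.
  apply Rdiv_lt_0_compat; [apply Rmult_lt_0_compat|]; lra.
Qed.

(** An explicit form of the decay of order [k^(-1/2)]; it gives both the bound by 1 and the limit
    0. *)
Lemma binom_coeff_0_sqr (k : nat) : binom_coeff 0 k ^ 2 * (INR k + 1) <= 1.
Proof.
  induction k as [|k IH].
  - simpl. lra.
  - cbn [binom_coeff]. rewrite S_INR. change (INR 0) with 0. nonneg_INR.
    set (x := INR k) in *. set (w := binom_coeff 0 k) in *.
    replace ((w * (x + / 2 - 0) / (x + 1)) ^ 2 * (x + 1 + 1)) with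
      ((w ^ 2 * (x + 1)) * ((x + / 2) ^ 2 * (x + 2) / (x + 1) ^ 3)) by (field; lra).
    apply Rle_trans with (1 * 1); [|lra].
    apply Rmult_le_compat; [| |exact IH|].
    + apply Rmult_le_pos; [apply pow2_ge_0 | lra].
    + apply Rmult_le_pos; [apply Rmult_le_pos; [apply pow2_ge_0|lra]|].
      left; apply Rinv_0_lt_compat, pow_lt; lra.
    (* Here [(x+1)^3 - (x+1/2)^2 (x+2) = 3x/4 + 1/2]. *)
    + apply Rle_div_l; [apply pow_lt; lra|]. nra.
Qed.

Lemma binom_coeff_0_le_1 (k : nat) : binom_coeff 0 k <= 1.
Proof.
  pose proof (binom_coeff_0_sqr k). pose proof (binom_coeff_0_pos k). nonneg_INR. nra.
Qed.

Lemma is_lim_seq_binom_coeff (m : nat) : is_lim_seq (binom_coeff m) 0.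
Proof.
  induction m as [|m IH].
  - apply (is_lim_seq_le_le (fun _ => 0) _ (fun k => sqrt (/ (INR k + 1)))).
    + intros k. pose proof (binom_coeff_0_pos k).
      pose proof (binom_coeff_0_sqr k). nonneg_INR. split; [lra|].
      rewrite <- (sqrt_pow2 (binom_coeff 0 k)) by lra.
      apply sqrt_le_1_alt.
      apply Rmult_le_reg_r with (INR k + 1); [lra|].
      rewrite Rinv_l; lra.
    + apply is_lim_seq_const.
    + rewrite <- sqrt_0.
      apply (is_lim_seq_continuous sqrt); [|exact is_lim_seq_inv_INR_succ].
      apply continuity_pt_sqrt; lra.
  - nonneg_INR.
    apply (is_lim_seq_ext
             (fun k => (2 * INR m + 1) / (2 * INR m + 1 - 2 * INR k) * binom_coeff m k)).
    + intros k. pose proof (half_integer_neq k m).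
      apply Rmult_eq_reg_r with (2 * INR m + 1 - 2 * INR k); [|lra].
      rewrite <- binom_coeff_S. field. lra.
    (* The denominator [2m + 1 - 2k] is an odd integer, so its absolute value is at least 1. *)
    + apply is_lim_seq_bounded_mult with (2 := IH) (M := 2 * INR m + 1).
      intros k. unfold Rdiv. rewrite Rabs_mult, (Rabs_pos_eq (2 * _ + 1)) by lra.
      apply Rle_trans with ((2 * INR m + 1) * 1); [|lra].
      apply Rmult_le_compat_l; [lra|].
      pose proof (half_integer_neq k m).
      rewrite Rabs_inv. apply Rle_trans with (/ 1); [|lra]. apply Rinv_le_contravar; [lra|].
      rewrite !INR_IZR_INZ.
      replace (2 * IZR (Z.of_nat m) + 1 - 2 * IZR (Z.of_nat k))
        with (IZR (2 * Z.of_nat m + 1 - 2 * Z.of_nat k))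
        by (rewrite minus_IZR, plus_IZR, !mult_IZR; ring).
      rewrite <- abs_IZR. apply IZR_le. lia.
Qed.

(** * The arcsine series, inside the interval of convergence and at its end point *)

Lemma CV_radius_ge_1 (a : nat -> R) :
  (forall k, 0 <= a k <= 1) -> Rbar_le 1 (CV_radius a).
Proof.
  intros H. apply (proj1 (CV_radius_bounded a)).
  exists 1. intros k. rewrite pow1, Rmult_1_r, Rabs_pos_eq; apply H.
Qed.

Lemma CV_radius_gt (a : nat -> R) (x : R) :
  (forall k, 0 <= a k <= 1) -> 0 <= x < 1 -> Rbar_lt (Rabs x) (CV_radius a).
Proof.
  intros H Hx. apply Rbar_lt_le_trans with (2 := CV_radius_ge_1 a H).
  simpl. rewrite Rabs_pos_eq; lra.
Qed.

Lemma binom_coeff_0_bounds (k : nat) : 0 <= binom_coeff 0 k <= 1.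
Proof.
  split; [left; apply binom_coeff_0_pos | apply binom_coeff_0_le_1].
Qed.

(** The coefficient of [s^(2k+1)] in [arcsin s]; as a power series in [x = s^2] it represents
    [arcsin s / s]. *)
Definition arcsin_coeff (k : nat) : R := binom_coeff 0 k / (2 * INR k + 1).

Lemma arcsin_coeff_bounds (k : nat) : 0 <= arcsin_coeff k <= 1.
Proof.
  unfold arcsin_coeff. nonneg_INR. pose proof (binom_coeff_0_bounds k). split.
  - apply Rmult_le_pos; [lra | left; apply Rinv_0_lt_compat; lra].
  - apply Rle_div_l; lra.
Qed.

Lemma sum_n_le_is_series (a : nat -> R) (l : R) (N : nat) :
  (forall k, 0 <= a k) -> is_series a l -> sum_n a N <= l.
Proof.
  intros Ha Hl. apply (is_lim_seq_incr_compare (sum_n a)); [exact Hl|].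
  intros n. rewrite sum_Sn. unfold plus; simpl. specialize (Ha (S n)). lra.
Qed.

Lemma is_series_PSeries (a : nat -> R) (x : R) :
  (forall k, 0 <= a k <= 1) -> 0 <= x < 1 ->
  is_series (fun k => a k * x ^ k) (PSeries a x).
Proof.
  intros Ha Hx. apply is_pseries_R, PSeries_correct, CV_radius_inside.
  now apply CV_radius_gt.
Qed.

Lemma PSeries_ge_0 (a : nat -> R) (x : R) :
  (forall k, 0 <= a k <= 1) -> 0 <= x < 1 -> 0 <= PSeries a x.
Proof.
  intros Ha Hx. pose proof (is_series_PSeries a x Ha Hx) as H.
  apply Rle_trans with (sum_n (fun k => a k * x ^ k) 0).
  - rewrite sum_O, Rmult_1_r. apply Ha.
  - apply sum_n_le_is_series; [|exact H].
    intros k. apply Rmult_le_pos; [apply Ha | apply pow_le; lra].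
Qed.

(** The equation [y' = x y' + y/2] of [y = (1-x)^(-1/2)], read on coefficients. *)
Lemma PS_derive_binom (k : nat) :
  PS_derive (binom_coeff 0) k
  = PS_plus (PS_incr_1 (PS_derive (binom_coeff 0))) (PS_scal (/ 2) (binom_coeff 0)) k.
Proof.
  unfold PS_derive, PS_plus, PS_scal.
  destruct k as [|k]; cbn -[INR binom_coeff];
    [simpl; unfold zero, mult; simpl; field|].
  unfold mult; cbn -[INR binom_coeff].
  rewrite (S_INR (S k)). cbn [binom_coeff]. rewrite S_INR. change (INR 0) with 0.
  nonneg_INR. field. lra.
Qed.

(** By the differential equation [(1-t) y' = y/2], the derivative [-y^2 + 2 y (1-t) y'] of
    [(1-t) y^2] vanishes. Squaring avoids real exponents; the sign of [y] is settled separately. *)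
Lemma PSeries_binom_sqr (x : R) :
  0 <= x < 1 -> (1 - x) * PSeries (binom_coeff 0) x ^ 2 = 1.
Proof.
  intros Hx.
  set (y := PSeries (binom_coeff 0)).
  set (dy := PSeries (PS_derive (binom_coeff 0))).
  assert (H0 : (1 - 0) * y 0 ^ 2 = 1) by (unfold y; rewrite PSeries_0; simpl; ring).
  destruct (Req_dec x 0) as [->|Hx0]; [exact H0|].
  assert (R1 : forall t, 0 <= t < 1 ->
             Rbar_lt (Rabs t) (CV_radius (binom_coeff 0)))
    by (intros; apply CV_radius_gt; [apply binom_coeff_0_bounds | assumption]).
  assert (ODE : forall t, 0 <= t < 1 -> (1 - t) * dy t = y t / 2).
  { intros t Ht. unfold dy, y.
    enough (PSeries (PS_derive (binom_coeff 0)) t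
            = t * PSeries (PS_derive (binom_coeff 0)) t + / 2 * PSeries (binom_coeff 0) t)
      by lra.
    rewrite <- PSeries_incr_1, <- PSeries_scal, <- PSeries_plus.
    - apply PSeries_ext, PS_derive_binom.
    - apply ex_pseries_incr_1, CV_radius_inside. rewrite CV_radius_derive. now apply R1.
    - apply ex_pseries_scal; [apply Rmult_comm|]. apply CV_radius_inside. now apply R1. }
  transitivity ((1 - 0) * y 0 ^ 2); [symmetry | exact H0].
  apply (eq_is_derive (fun t => (1 - t) * y t ^ 2) 0 x); [|lra].
  intros t Ht.
  assert (D : is_derive y t (dy t)) by (apply is_derive_PSeries, R1; lra).
  assert (O := ODE t ltac:(lra)).
  replace (@zero R_NormedModule) with (- y t ^ 2 + 2 * y t * ((1 - t) * dy t)).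
  - auto_derive; [now exists (dy t)|].
    replace (Derive (fun x0 => y x0) t) with (dy t)
      by (symmetry; now apply is_derive_unique).
    ring.
  - rewrite O. unfold zero; simpl. field.
Qed.

(** The left side is the derivative of [s * p(s^2)] at [s^2 = x], for [p] the series of
    [arcsin_coeff]: the operator multiplies the [k]-th coefficient by [2k+1], cancelling its
    denominator. *)
Lemma PSeries_arcsin_derive (x : R) :
  0 <= x < 1 ->
  PSeries arcsin_coeff x + 2 * (x * PSeries (PS_derive arcsin_coeff) x)
  = PSeries (binom_coeff 0) x.
Proof.
  intros Hx.
  assert (R1 := CV_radius_gt arcsin_coeff x arcsin_coeff_bounds Hx).
  rewrite <- PSeries_incr_1, <- PSeries_scal, <- PSeries_plus.
  - apply PSeries_ext. intros k.
    unfold PS_derive, PS_plus, PS_scal, arcsin_coeff.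
    destruct k as [|k]; cbn -[INR binom_coeff];
      [simpl; unfold zero, mult; simpl; field|].
    unfold mult; cbn -[INR binom_coeff]. rewrite S_INR. nonneg_INR. field. lra.
  - now apply CV_radius_inside.
  - apply ex_pseries_scal; [apply Rmult_comm|].
    apply ex_pseries_incr_1, CV_radius_inside. now rewrite CV_radius_derive.
Qed.

Lemma sin_sqr_bounds (t : R) : 0 <= t < PI / 2 -> 0 <= sin t ^ 2 < 1.
Proof.
  intros Ht. pose proof PI_RGT_0. split; [apply pow2_ge_0|].
  assert (0 < cos t) by (apply cos_gt_0; lra).
  pose proof (sin2_cos2 t) as E. unfold Rsqr in E. nra.
Qed.

(** This is [arcsin (sin t) = t]: by the chain rule the left side has derivative
    [cos t * (1 - sin^2 t)^(-1/2) = 1], and both sides vanish at 0. *)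
Lemma sin_mult_PSeries_arcsin (t : R) :
  0 <= t < PI / 2 -> sin t * PSeries arcsin_coeff (sin t ^ 2) = t.
Proof.
  intros Ht.
  destruct (Req_dec t 0) as [->|Ht0]; [rewrite sin_0; ring|].
  set (p := PSeries arcsin_coeff). set (dp := PSeries (PS_derive arcsin_coeff)).
  enough (sin 0 * p (sin 0 ^ 2) - 0 = sin t * p (sin t ^ 2) - t)
    by (rewrite sin_0 in H; lra).
  apply (eq_is_derive (fun s => sin s * p (sin s ^ 2) - s) 0 t); [|lra].
  intros s Hs.
  assert (Hs2 := sin_sqr_bounds s ltac:(lra)).
  assert (D : is_derive p (sin s ^ 2) (dp (sin s ^ 2)))
    by (apply is_derive_PSeries, CV_radius_gt; [apply arcsin_coeff_bounds | exact Hs2]).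
  assert (E : cos s * PSeries (binom_coeff 0) (sin s ^ 2) = 1).
  { assert (Hc : 0 < cos s) by (apply cos_gt_0; lra).
    assert (Hy := PSeries_ge_0 _ _ binom_coeff_0_bounds Hs2).
    assert (E := PSeries_binom_sqr _ Hs2).
    pose proof (sin2_cos2 s) as E2. unfold Rsqr in E2.
    set (y := PSeries (binom_coeff 0) (sin s ^ 2)) in *.
    (* Nonnegativity selects the root 1 of [(cos s * y)^2 = 1]. *)
    assert (0 <= cos s * y) by (apply Rmult_le_pos; lra).
    assert ((cos s * y) ^ 2 = 1)
      by (rewrite <- E; replace (1 - sin s ^ 2) with (cos s * cos s) by lra; ring).
    nra. }
  rewrite <- PSeries_arcsin_derive in E by exact Hs2. fold p dp in E.
  replace (@zero R_NormedModule)
    with (cos s * (p (sin s ^ 2) + 2 * (sin s ^ 2 * dp (sin s ^ 2))) - 1)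
    by (rewrite E; unfold zero; simpl; ring).
  assert (D' : Derive (fun x => p x) (sin s ^ 2) = dp (sin s ^ 2))
    by now apply is_derive_unique.
  auto_derive.
  - eexists; apply D.
  - simpl in *. rewrite D'. ring.
Qed.

(* At the end point of the interval of convergence, nonnegativity of the coefficients
   replaces Abel's theorem. *)
Lemma is_series_arcsin_coeff : is_series arcsin_coeff (PI / 2).
Proof.
  assert (HPI := PI_RGT_0).
  (* Angles tending to [PI / 2] from below, so that [sin (th n) ^ 2] stays below 1. *)
  set (th := fun n : nat => PI / 2 - PI / 2 * / (INR n + 1)).
  assert (Hth : forall n, 0 <= th n < PI / 2).
  { intros n. unfold th. nonneg_INR.
    assert (0 < / (INR n + 1) <= 1).
    { split; [apply Rinv_0_lt_compat; lra|].
      apply Rle_trans with (/ 1); [|lra]. apply Rinv_le_contravar; lra. }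
    nra. }
  assert (Lth : is_lim_seq th (PI / 2)).
  { replace (Finite (PI / 2)) with (Finite (PI / 2 - PI / 2 * 0)) by (f_equal; ring).
    apply is_lim_seq_minus'; [apply is_lim_seq_const|].
    apply (is_lim_seq_scal_l _ (PI / 2) 0 is_lim_seq_inv_INR_succ). }
  assert (Hx := fun n => sin_sqr_bounds (th n) (Hth n)).
  assert (Hsin : forall n, 0 <= sin (th n))
    by (intros n; apply sin_ge_0; specialize (Hth n); lra).
  assert (Ls : is_lim_seq (fun n => sin (th n)) 1).
  { rewrite <- sin_PI2. apply (is_lim_seq_continuous sin); [|exact Lth].
    apply continuity_sin. }
  assert (Hterm : forall x k, 0 <= x -> 0 <= arcsin_coeff k * x ^ k)
    by (intros; apply Rmult_le_pos; [apply arcsin_coeff_bounds | now apply pow_le]).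
  (* For fixed [N] the truncated arcsine polynomial [q] satisfies [q (sin (th n)) <= th n];
     continuity of [q] at 1 gives the bound. *)
  assert (Hsum : forall N, sum_n arcsin_coeff N <= PI / 2).
  { intros N.
    set (q := fun s => s * sum_n (fun k => arcsin_coeff k * (s ^ 2) ^ k) N).
    assert (Cq : continuity_pt q 1).
    { apply continuity_pt_filterlim. apply (ex_derive_continuous q).
      unfold q. apply ex_derive_mult; [apply ex_derive_id|].
      clear. induction N as [|N IH].
      - apply (ex_derive_ext (fun _ => arcsin_coeff 0)).
        + intros s. rewrite sum_O. simpl. symmetry. apply Rmult_1_r.
        + apply ex_derive_const.
      - apply (ex_derive_ext (fun s =>
          sum_n (fun k => arcsin_coeff k * (s ^ 2) ^ k) N
          + arcsin_coeff (S N) * (s ^ 2) ^ S N)).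
        + intros s. now rewrite sum_Sn.
        + apply (ex_derive_plus (V := R_NormedModule)); [exact IH|]. auto_derive; auto. }
    replace (sum_n arcsin_coeff N) with (q 1).
    2: { unfold q. rewrite Rmult_1_l. apply sum_n_ext.
         intros k. rewrite !pow1. apply Rmult_1_r. }
    apply (is_lim_seq_le (fun n => q (sin (th n))) th (q 1) (PI / 2));
      [|now apply is_lim_seq_continuous | exact Lth].
    intros n. rewrite <- (sin_mult_PSeries_arcsin (th n)) at 2 by apply Hth.
    apply Rmult_le_compat_l; [apply Hsin|].
    apply sum_n_le_is_series; [intros k; apply Hterm, Hx|].
    apply is_series_PSeries; [apply arcsin_coeff_bounds | apply Hx]. }
  destruct (ex_finite_lim_seq_incr (sum_n arcsin_coeff) (PI / 2)) as [l Hl];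
    [|exact Hsum|].
  { intros n. rewrite sum_Sn. pose proof (arcsin_coeff_bounds (S n)).
    unfold plus; simpl; lra. }
  enough (l = PI / 2) as <- by exact Hl.
  apply Rle_antisym.
  - exact (is_lim_seq_le _ _ l (PI / 2) Hsum Hl (is_lim_seq_const _)).
  (* Conversely, powers of [sin (th n) ^ 2] are at most 1, so [th n <= sin (th n) * l] termwise, and
     [n] tends to infinity. *)
  - apply (is_lim_seq_le th (fun n => sin (th n) * l) (PI / 2) l); [|exact Lth|].
    + intros n. rewrite <- (sin_mult_PSeries_arcsin (th n)) at 1 by apply Hth.
      apply Rmult_le_compat_l; [apply Hsin|].
      assert (Hp := is_series_PSeries _ _ arcsin_coeff_bounds (Hx n)).
      refine (is_lim_seq_le _ _ (Finite _) l _ Hp Hl).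
      intros N. rewrite !sum_n_Reals. apply sum_Rle. intros k _.
      rewrite <- (Rmult_1_r (arcsin_coeff k)) at 2.
      apply Rmult_le_compat_l; [apply arcsin_coeff_bounds|].
      rewrite <- (pow1 k). apply pow_incr. specialize (Hx n). lra.
    + replace (Finite l) with (Finite (1 * l)) by (f_equal; ring).
      apply is_lim_seq_mult'; [exact Ls | apply is_lim_seq_const].
Qed.

(** * Summation of the 2F1 series and of its first moment by telescoping *)

Lemma is_series_lincomb (x y : R) (a b c : nat -> R) (la lb lc : R) :
  is_series a la -> is_series b lb ->
  (forall k, c k = x * a k + y * b k) -> lc = x * la + y * lb -> is_series c lc.
Proof.
  intros Ha Hb Hc ->.
  apply (is_series_ext (fun k => x * a k + y * b k)).
  - intros k. symmetry. apply Hc.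
  - exact (is_series_plus _ _ _ _ (is_series_scal x _ _ Ha) (is_series_scal y _ _ Hb)).
Qed.

(* The term of 2F1(1/2+m, 1/2-m; 5/2+m; 1). *)
Definition gauss_term (m k : nat) : R :=
  (2 * INR m + 1) * (2 * INR m + 3)
  / ((2 * INR k + 2 * INR m + 1) * (2 * INR k + 2 * INR m + 3)) * binom_coeff m k.

(** Given by the recurrence that the series satisfies in [m], so that the induction is immediate;
    [gauss_sum_closed_form] recovers the product formula. The initial value is [3/4 * PI/2]. *)
Fixpoint gauss_sum (m : nat) : R :=
  match m with
  | O => 3 * PI / 8
  | S j => gauss_sum j * (5 / 2 + INR j) / (4 * (INR j + 1))
  end.

Lemma is_series_gauss_term_0 : is_series (gauss_term 0) (gauss_sum 0).
Proof.
  (* The factor [INR k] kills the boundary term at 0 and cancels the [k + 1] under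
     [binom_coeff 0 (S k)]; the shifted denominator supplies the [2k + 3] of [gauss_term]. *)
  set (b := fun k => INR k / (2 * (2 * INR k + 1))).
  assert (T : is_series (fun k => b (S k) * binom_coeff 0 (S k) - b k * binom_coeff 0 k)
                        (- (b 0%nat * binom_coeff 0 0))).
  { apply (is_series_telescope (fun k => b k * binom_coeff 0 k)).
    apply is_lim_seq_bounded_mult with (M := 1); [|apply is_lim_seq_binom_coeff].
    intros k. unfold b. nonneg_INR. rewrite Rabs_pos_eq.
    - apply Rle_div_l; lra.
    - apply Rmult_le_pos; [lra | left; apply Rinv_0_lt_compat; lra]. }
  replace (b 0%nat) with 0 in T by (unfold b; simpl; field; lra).
  rewrite Rmult_0_l, Ropp_0 in T.
  refine (is_series_lincomb (3 / 4) 3 _ _ _ _ _ _ is_series_arcsin_coeff T _ _);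
    [intros k | simpl; field; lra].
  unfold gauss_term, arcsin_coeff, b. cbn [binom_coeff]. rewrite S_INR.
  change (INR 0) with 0. nonneg_INR. field. lra.
Qed.

(* [al] and [be] solve the linear system expressing that the recurrence in [m]
   has a certificate of this shape (creative telescoping). *)
Lemma is_series_gauss_term_S (m : nat) (s : R) :
  is_series (gauss_term m) s ->
  is_series (gauss_term (S m)) (s * (5 / 2 + INR m) / (4 * (INR m + 1))).
Proof.
  intros Hs. nonneg_INR.
  set (al := - 2 / (2 * INR m + 3)). set (be := - 3 - al).
  set (b := fun k => INR k * (al * INR k + be)
                     / ((2 * INR k + 2 * INR m + 1) * (2 * INR k + 2 * INR m + 3))).
  set (v := binom_coeff (S m)).
  assert (T : is_series (fun k => b (S k) * v (S k) - b k * v k)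
                        (- (b 0%nat * v 0%nat))).
  { apply (is_series_telescope (fun k => b k * v k)).
    (* The numerator is quadratic in [k] with [al] in [[-1, 0]] and [be] in [[-3, -2]], hence
       dominated by 3 times the denominator. *)
    apply is_lim_seq_bounded_mult with (M := 3); [|apply is_lim_seq_binom_coeff].
    intros k. unfold b. nonneg_INR.
    set (x := INR k) in *. set (y := INR m) in *.
    assert (Hal : - 1 <= al <= 0).
    { unfold al. split.
      - apply Rle_div_r; lra.
      - apply Rle_div_l; lra. }
    assert (0 < (2 * x + 2 * y + 1) * (2 * x + 2 * y + 3)) by nra.
    unfold Rdiv. rewrite Rabs_mult, (Rabs_pos_eq (/ _))
      by (left; apply Rinv_0_lt_compat; lra).
    apply Rle_div_l; [lra|]. unfold be. apply Rabs_le. split; nra. }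
  replace (b 0%nat) with 0 in T by (unfold b; simpl; field; lra).
  rewrite Rmult_0_l, Ropp_0 in T.
  refine (is_series_lincomb ((5 / 2 + INR m) / (4 * (INR m + 1)))
    ((2 * INR m + 3) * (2 * INR m + 5) / (4 * (INR m + 1))) _ _ _ _ _ _ Hs T _ _);
    [intros k | simpl; field; lra].
  (* With every coefficient expressed through [v k], the certificate becomes an identity of rational
     functions. *)
  assert (E : binom_coeff m k = v k * (2 * INR m + 1 - 2 * INR k) / (2 * INR m + 1)).
  { unfold v. rewrite <- binom_coeff_S. field. lra. }
  unfold gauss_term. rewrite E. fold v.
  replace (v (S k)) with (v k * (INR k + / 2 - INR (S m)) / (INR k + 1)) by reflexivity.
  unfold b, be, al. rewrite !S_INR. nonneg_INR. field. lra.
Qed.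

Lemma is_series_gauss_term (m : nat) : is_series (gauss_term m) (gauss_sum m).
Proof.
  induction m as [|m IH].
  - apply is_series_gauss_term_0.
  - now apply is_series_gauss_term_S.
Qed.

(** With [c = 5/2 + m], telescope [k (k+c-1) t_m(k)]. The term ratio turns its shift into
    [(k+1/2+m)(k+1/2-m) t_m(k)]; the quadratic parts cancel and the difference is
    [-(m+1/2)(k-(1/2-m)) t_m(k)]. *)
Lemma is_series_INR_gauss_term (m : nat) :
  is_series (fun k => INR k * gauss_term m k) ((/ 2 - INR m) * gauss_sum m).
Proof.
  nonneg_INR.
  set (b := fun k => INR k * (INR k + 3 / 2 + INR m)
                     * ((2 * INR m + 1) * (2 * INR m + 3)
                     / ((2 * INR k + 2 * INR m + 1) * (2 * INR k + 2 * INR m + 3)))).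
  set (v := binom_coeff m).
  assert (T : is_series (fun k => b (S k) * v (S k) - b k * v k)
                        (- (b 0%nat * v 0%nat))).
  { apply (is_series_telescope (fun k => b k * v k)).
    apply is_lim_seq_bounded_mult with (M := (2 * INR m + 1) * (2 * INR m + 3));
      [|apply is_lim_seq_binom_coeff].
    intros k. unfold b. nonneg_INR.
    set (x := INR k) in *. set (y := INR m) in *.
    assert (0 < (2 * x + 2 * y + 1) * (2 * x + 2 * y + 3)) by nra.
    rewrite Rabs_pos_eq.
    (* The factor [x + 3/2 + y] is half of [2x + 2y + 3], so the quotient is bounded. *)
    - replace (x * (x + 3 / 2 + y) * ((2 * y + 1) * (2 * y + 3) /
         ((2 * x + 2 * y + 1) * (2 * x + 2 * y + 3))))
       with ((2 * y + 1) * (2 * y + 3) * (x / (2 * (2 * x + 2 * y + 1)))) by (field; lra).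
      rewrite <- (Rmult_1_r ((2 * y + 1) * (2 * y + 3))) at 2.
      apply Rmult_le_compat_l; [nra|]. apply Rle_div_l; lra.
    - apply Rmult_le_pos; [apply Rmult_le_pos; lra|].
      apply Rmult_le_pos; [nra | left; apply Rinv_0_lt_compat; lra]. }
  replace (b 0%nat) with 0 in T by (unfold b; simpl; field; lra).
  rewrite Rmult_0_l, Ropp_0 in T.
  refine (is_series_lincomb (/ 2 - INR m)
    (- / (INR m + / 2)) _ _ _ _ _ _ (is_series_gauss_term m) T _ _);
    [intros k | simpl; field; lra].
  unfold gauss_term. fold v.
  replace (v (S k)) with (v k * (INR k + / 2 - INR m) / (INR k + 1)) by reflexivity.
  unfold b. rewrite !S_INR. nonneg_INR. field. lra.
Qed.

(** * Return to complex Pochhammer symbols and the 3F2 series *)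

Open Scope C_scope.

Lemma Cneq_0_Re (z : C) : (0 < Re z)%R -> z <> 0.
Proof.
  intros H ->. simpl in H. lra.
Qed.

Lemma pochhammer_neq_0 (l : C) (k : nat) : (0 < Re l)%R -> pochhammer l k <> 0.
Proof.
  intros Hl. induction k as [|k IH]; cbn [pochhammer].
  - apply C1_nz.
  - apply Cmult_neq_0; [exact IH|]. apply Cneq_0_Re.
    nonneg_INR. destruct l; simpl in *. lra.
Qed.

(** Both sides equal [(l)_(k+1)]. *)
Lemma pochhammer_shift (l : C) (k : nat) :
  pochhammer (l + 1) k * l = pochhammer l k * (l + INR k).
Proof.
  induction k as [|k IH]; cbn [pochhammer].
  - simpl. ring.
  - rewrite S_INR, RtoC_plus.
    transitivity ((pochhammer (l + 1) k * l) * (l + 1 + INR k)); [ring|].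
    rewrite IH. ring.
Qed.

Lemma pochhammer_RtoC_binom (m k : nat) :
  pochhammer (1 / 2 - INR m) k = INR (fact k) * binom_coeff m k.
Proof.
  induction k as [|k IH]; cbn [pochhammer].
  - simpl. ring.
  - rewrite IH, fact_simpl, mult_INR, S_INR. cbn [binom_coeff].
    replace (1 / 2 - INR m + INR k) with (RtoC (/ 2 - INR m + INR k)).
    + rewrite <- !RtoC_mult. apply f_equal. nonneg_INR. field. lra.
    + rewrite RtoC_plus, RtoC_minus, RtoC_inv by lra. field.
Qed.

Lemma hypergeom_term_gauss (m k : nat) (d : C) :
  (0 < Re d)%R ->
  hypergeom_term [1 / 2 + INR m; 1 / 2 - INR m; d + 1] [5 / 2 + INR m; d] 1 k
  = gauss_term m k + / d * (INR k * gauss_term m k)%R.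
Proof.
  intros Hd. nonneg_INR.
  assert (Hd0 := Cneq_0_Re d Hd).
  assert (Hdk := pochhammer_neq_0 d k Hd).
  set (a := 1 / 2 + INR m).
  assert (Ha : a = RtoC (1 / 2 + INR m)).
  { unfold a, Cdiv. rewrite <- RtoC_inv, <- RtoC_mult, <- RtoC_plus by lra. reflexivity. }
  (* The lower parameter exceeds the upper one by 2, so two uses of [pochhammer_shift] make their
     quotient rational in [k]. *)
  assert (Ea : 5 / 2 + INR m = a + 1 + 1) by (unfold a; field).
  assert (Hra : (0 < Re a)%R) by (rewrite Ha; simpl; lra).
  assert (Hra1 : (0 < Re (a + 1))%R) by (rewrite Ha; simpl; lra).
  assert (Hak : a + INR k <> 0) by (apply Cneq_0_Re; rewrite Ha; simpl; lra).
  assert (Hak1 : a + 1 + INR k <> 0) by (apply Cneq_0_Re; rewrite Ha; simpl; lra).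
  assert (Ha0 := Cneq_0_Re _ Hra). assert (Ha1 := Cneq_0_Re _ Hra1).
  assert (Hfact : RtoC (INR (fact k)) <> 0).
  { intros H'. apply RtoC_inj in H'. now apply (INR_fact_neq_0 k). }
  assert (G : RtoC (gauss_term m k)
              = a * (a + 1) / ((a + INR k) * (a + 1 + INR k)) * binom_coeff m k).
  { rewrite Ha. unfold gauss_term, Cdiv.
    rewrite <- !RtoC_plus, <- !RtoC_mult, <- RtoC_inv, <- !RtoC_mult by nra.
    apply f_equal. field. lra. }
  assert (P2 : pochhammer (a + 1 + 1) k
               = pochhammer a k * (a + INR k) * (a + 1 + INR k) / (a * (a + 1))).
  { rewrite <- pochhammer_shift.
    transitivity (pochhammer (a + 1) k * (a + 1 + INR k) / (a + 1)); [|field; now split].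
    rewrite <- pochhammer_shift. field. exact Ha1. }
  assert (Pd : pochhammer (d + 1) k = pochhammer d k * (d + INR k) / d)
    by (rewrite <- pochhammer_shift; field; exact Hd0).
  assert (Pa := pochhammer_neq_0 a k Hra).
  unfold hypergeom_term, pochhammer_prod. cbn [fold_right].
  rewrite Ea, P2, Pd, pochhammer_RtoC_binom, RtoC_mult, G, Cpow_1_l.
  field. repeat split; assumption.
Qed.

Lemma gauss_sum_closed_form (m : nat) :
  RtoC (gauss_sum m)
  = 3 * PI / (2 ^ (2 * m + 3) * INR (fact m)) * pochhammer (5 / 2) m.
Proof.
  induction m as [|m IH].
  - change (gauss_sum 0) with (3 * PI / 8)%R. simpl. unfold Rdiv.
    rewrite !RtoC_mult, RtoC_inv by lra.
    replace (RtoC 8) with (2 * (2 * 2)) by (rewrite <- !RtoC_mult; f_equal; ring).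
    field.
  - nonneg_INR. cbn [pochhammer gauss_sum].
    unfold Rdiv at 1. rewrite !RtoC_mult, IH, RtoC_inv, RtoC_plus by lra.
    unfold Rdiv. rewrite !RtoC_mult, RtoC_inv, RtoC_plus by lra.
    (* The two extra factors 2 form the 4 in the recurrence of [gauss_sum]. *)
    replace (2 * S m + 3)%nat with (S (S (2 * m + 3))) by lia.
    cbn [Cpow]. rewrite fact_simpl, mult_INR, S_INR, RtoC_mult, RtoC_plus.
    assert (Hfact : RtoC (INR (fact m)) <> 0).
    { intros H'. apply RtoC_inj in H'. now apply (INR_fact_neq_0 m). }
    assert (Hm : INR m + 1 <> 0) by (apply Cneq_0_Re; simpl; lra).
    assert (H2 : 2 ^ (2 * m + 3) <> 0) by (apply Cpow_nz, Cneq_0_Re; simpl; lra).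
    replace (RtoC 4) with (2 * 2) by (rewrite <- RtoC_mult; f_equal; ring).
    field. repeat split; auto.
Qed.

Theorem theorem2 : forall (m : nat) (d : C), (0 < Re d)%R ->
  is_hypergeom
    [1 / 2 + INR m; 1 / 2 - INR m; d + 1]
    [5 / 2 + INR m; d]
    1
    ((1 + (1 - 2 * INR m) / (2 * d))
     * (3 * PI / (2 ^ (2 * m + 3) * INR (fact m)))
     * pochhammer (5 / 2) m).
Proof.
  intros m d Hd. unfold is_hypergeom.
  rewrite <- Cmult_assoc, <- gauss_sum_closed_form.
  (* The value is split along the weight [1 + k/d] into the plain sum and the first moment. *)
  replace ((1 + (1 - 2 * INR m) / (2 * d)) * gauss_sum m)
    with (gauss_sum m + / d * RtoC ((/ 2 - INR m) * gauss_sum m)).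
  2: { rewrite RtoC_mult, RtoC_minus, RtoC_inv by lra. field. now apply Cneq_0_Re. }
  apply is_series_ext with
    (a := fun k => RtoC (gauss_term m k) + / d * RtoC (INR k * gauss_term m k)).
  - intros k. symmetry. now apply hypergeom_term_gauss.
  - apply @is_series_plus.
    + apply is_series_RtoC, is_series_gauss_term.
    + apply (is_series_scal (K := C_AbsRing) (V := C_NormedModule) (/ d)
               (fun k => RtoC (INR k * gauss_term m k))).
      apply is_series_RtoC, is_series_INR_gauss_term.
Qed.
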